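(* Let the plant $(A,B,C)$ and the weights $W,V,Q,R$ be such that $(A,B)$ and $(A,W^{1/2})$ are controllable, and $(C,A)$ and $(Q^{1/2},A)$ are observable. Then the set $\mathcal{C}_n$ of full-order strictly proper stabilizing controllers has at most two path-connected components.
   Context: Fix integers $n,m,p\ge 1$, real matrices $A\in\mathbb{R}^{n\times n}$, $B\in\mathbb{R}^{n\times m}$, $C\in\mathbb{R}^{p\times n}$ (the plant $\dot x=Ax+Bu+w$, $y=Cx+v$), and real symmetric matrices $W\succeq 0$ ($n\times n$), $V\succ 0$ ($p\times p$), $Q\succeq 0$ ($n\times n$), $R\succ 0$ ($m\times m$). A real square matrix is called stable if all its eigenvalues have negative real part. The set of full-order strictly proper stabilizing controllers is $$\mathcal{C}_n=\left\{\mathsf{K}=\begin{bmatrix}0_{m\times p}&C_{\mathsf K}\\ B_{\mathsf K}&A_{\mathsf K}\end{bmatrix}\in\mathbb{R}^{(m+n)\times(p+n)}\ \middle|\ A_{\mathsf K}\in\mathbb{R}^{n\times n},\,B_{\mathsf K}\in\mathbb{R}^{n\times p},\,C_{\mathsf K}\in\mathbb{R}^{m\times n},\ \begin{bmatrix}A&BC_{\mathsf K}\\ B_{\mathsf K}C&A_{\mathsf K}\end{bmatrix}\text{ is stable}\right\},$$ with the topology induced from the Euclidean space of matrices. *)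

(* Defs.v *)
From mathcomp Require Import all_boot all_order all_algebra.
From mathcomp Require Import complex.
From mathcomp Require Import all_classical all_reals all_analysis.

Set Implicit Arguments.
Unset Strict Implicit.
Unset Printing Implicit Defensive.

Import Order.TTheory GRing.Theory Num.Theory.
Import numFieldNormedType.Exports.

Local Open Scope classical_set_scope.
Local Open Scope ring_scope.

Definition psdmx (F : realType) (n : nat) (S : 'M[F]_n) : Prop :=
  S^T = S /\ forall x : 'cV[F]_n, 0 <= (x^T *m S *m x) 0 0.

Definition pdmx (F : realType) (n : nat) (S : 'M[F]_n) : Prop :=
  S^T = S /\ forall x : 'cV[F]_n, x != 0 -> 0 < (x^T *m S *m x) 0 0.

(* [S] is the principal square root of [M]; it exists and is unique when [M] is
   positive semidefinite. *)
Definition is_psd_sqrt (F : realType) (n : nat) (S M : 'M[F]_n) : Prop :=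
  psdmx S /\ S *m S = M.

(* Eigenvalues are the complex ones, hence the embedding into [F[i]]; [Re] has
   values in [F]. *)
Definition stable (F : realType) (n : nat) (M : 'M[F]_n) : Prop :=
  forall z : complex F,
    eigenvalue (map_mx (real_complex F) M) z -> complex.Re z < 0.

(* Kalman matrix [B, AB, ..., A^(n-1) B]. *)
Definition controllability_mx (F : realType) (n m : nat)
    (A : 'M[F]_n) (B : 'M[F]_(n, m)) : 'M[F]_(n, \sum_(k < n) m) :=
  \mxrow_(k < n) (A ^+ k *m B).

Definition observability_mx (F : realType) (n p : nat)
    (C : 'M[F]_(p, n)) (A : 'M[F]_n) : 'M[F]_(\sum_(k < n) p, n) :=
  \mxcol_(k < n) (C *m A ^+ k).

Definition controllable (F : realType) (n m : nat)
    (A : 'M[F]_n) (B : 'M[F]_(n, m)) : Prop :=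
  \rank (controllability_mx A B) = n.

Definition observable (F : realType) (n p : nat)
    (C : 'M[F]_(p, n)) (A : 'M[F]_n) : Prop :=
  \rank (observability_mx C A) = n.

Definition stabilizing_controllers (F : realType) (n m p : nat)
    (A : 'M[F]_n) (B : 'M[F]_(n, m)) (C : 'M[F]_(p, n)) :
    set 'M[F]_(m + n, p + n) :=
  [set K | exists (AK : 'M[F]_n) (BK : 'M[F]_(n, p)) (CK : 'M[F]_(m, n)),
     K = block_mx 0 CK BK AK /\
     stable (block_mx A (B *m CK) (BK *m C) AK)].

(* [x] and [y] are joined by a path in [S]. A map into [S] is continuous for
   the induced topology iff it is continuous into the ambient space [T]. *)
Definition path_joined (F : realType) (T : topologicalType) (S : set T)
    (x y : T) : Prop :=
  exists f : F -> T,
    [/\ {within `[0, 1], continuous f}, f 0 = x, f 1 = y &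
        f @` `[0, 1] `<=` S].

Definition path_component (F : realType) (T : topologicalType) (S : set T)
    (x : T) : set T := [set y | path_joined F S x y].

Definition path_components (F : realType) (T : topologicalType) (S : set T) :
    set (set T) := [set path_component F S x | x in S].

(* Main.v *)
Require Import Defs.
From mathcomp Require Import all_boot all_order all_algebra.
From mathcomp Require Import complex.
From mathcomp Require Import all_classical all_reals all_analysis.
From mathcomp Require Import ring lra.

Set Implicit Arguments.
Unset Strict Implicit.
Unset Printing Implicit Defensive.

Import Order.TTheory GRing.Theory Num.Theory.
Import numFieldNormedType.Exports.

Local Open Scope classical_set_scope.
Local Open Scope ring_scope.
Local Open Scope card_scope.

(* If [K] is stabilizing, its closed loop has a Lyapunov certificate
   [P = [X, Pi; Pi^T, W] > 0], which may be perturbed to make [Pi] invertible.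
   Changing the controller coordinates by [T = Pi W^-1] turns it into
   [P = [S + Z, Z; Z, Z]]. In the coordinates (estimation error, plant state) the
   Lyapunov inequality is then a block inequality whose diagonal blocks are linear
   matrix inequalities in [X = S + Z], [Y = S^-1], [G = C_K Z], [H = Y B_K], and
   whose off-diagonal block is affine in [A_K]: a segment in [A_K] kills it. The
   controllers so obtained are a continuous image of a convex set. Hence every
   controller is, up to a similarity [T], joined to a fixed one [c0]; as the
   invertible matrices of a given determinant sign are path connected, it is
   joined to [c0] or to the conjugate of [c0] by a matrix of negative determinant. *)

(* Once distributivity has expanded both sides, an identity between matrices is an
   identity in the commutative ring of entries, the products being atoms. *)
Ltac mx_abstract :=
  repeat match goal with
  | |- context [@mulmx ?R ?m ?n ?p ?a ?b] => move: (@mulmx R m n p a b) => ?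
  end.

Ltac mx_distr :=
  rewrite ?(mulmxDl, mulmxDr, mulNmx, mulmxN, mul0mx, mulmx0, mul1mx, mulmx1,
            =^~ scalemxAl, =^~ scalemxAr, mulmxA).

Ltac mx_ring :=
  mx_distr; mx_abstract; apply/matrixP => ? ?; rewrite !mxE; ring.

Lemma trmxD (V : zmodType) m n (M N : 'M[V]_(m, n)) : (M + N)^T = M^T + N^T.
Proof. exact: raddfD. Qed.

Lemma trmxN (V : zmodType) m n (M : 'M[V]_(m, n)) : (- M)^T = - M^T.
Proof. exact: raddfN. Qed.

Lemma unitmx_lblock (K : fieldType) m n (M : 'M[K]_m) (N : 'M[K]_n) L :
  (block_mx M 0 L N \in unitmx) = (M \in unitmx) && (N \in unitmx).
Proof. by rewrite !unitmxE det_lblock unitrM. Qed.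

(** * Positive definite matrices: congruence, Schur complements, perturbation *)

Section PositiveDefinite.
Context {F : realType}.

Lemma pdmxD n (M N : 'M[F]_n) : pdmx M -> pdmx N -> pdmx (M + N).
Proof.
move=> [Ms Mp] [Ns Np]; split=> [|x x0]; first by rewrite linearD /= Ms Ns.
by rewrite mulmxDr mulmxDl mxE addr_gt0 ?Mp ?Np.
Qed.

Lemma pdmxZ n a (M : 'M[F]_n) : 0 < a -> pdmx M -> pdmx (a *: M).
Proof.
move=> a0 [Ms Mp]; split=> [|x x0]; first by rewrite linearZ /= Ms.
by rewrite -scalemxAr -scalemxAl mxE mulr_gt0 ?Mp.
Qed.

Lemma pdmx_segment n (M N : 'M[F]_n) t : 0 <= t <= 1 -> pdmx M -> pdmx N ->
  pdmx ((1 - t) *: M + t *: N).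
Proof.
move=> /andP[]; rewrite le_eqVlt => /predU1P[<-|t0].
  by rewrite subr0 scale1r scale0r addr0.
rewrite le_eqVlt => /predU1P[->|t1].
  by rewrite subrr scale1r scale0r add0r.
by move=> pM pN; apply: pdmxD; apply: pdmxZ => //; rewrite subr_gt0.
Qed.

Lemma pdmx_congr n (U M : 'M[F]_n) : U \in unitmx -> pdmx M ->
  pdmx (U *m M *m U^T).
Proof.
move=> Uu [Ms Mp]; split=> [|x x0]; first by rewrite !trmx_mul trmxK Ms mulmxA.
have := Mp (U^T *m x); rewrite trmx_mul trmxK !mulmxA; apply.
apply: contra_neq x0 => /(congr1 (mulmx (invmx U^T))).
by rewrite mulmxA mulVmx ?unitmx_tr// mul1mx mulmx0.
Qed.

Lemma pdmx_congrE n (U M : 'M[F]_n) : U \in unitmx ->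
  pdmx (U *m M *m U^T) <-> pdmx M.
Proof.
move=> Uu; split=> [|/pdmx_congr]; last exact.
move=> /(@pdmx_congr _ (invmx U) _); rewrite unitmx_inv => /(_ Uu).
by rewrite !mulmxA mulVmx// mul1mx -mulmxA -trmx_mul mulVmx// trmx1 mulmx1.
Qed.

Lemma pdmx_scalar n a : 0 < a -> pdmx (a%:M : 'M[F]_n).
Proof.
move=> a0; split=> [|x x0]; first by rewrite tr_scalar_mx.
rewrite mul_mx_scalar -scalemxAl mxE mulr_gt0// mxE.
have /cV0Pn[i xi] := x0.
rewrite (bigD1 i)//= ltr_wpDr ?sumr_ge0// => [j _|].
  by rewrite mxE -expr2 sqr_ge0.
by rewrite mxE -expr2 exprn_even_gt0.
Qed.

Lemma pdmx_unit n (M : 'M[F]_n) : pdmx M -> M \in unitmx.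
Proof.
move=> [Ms Mp]; rewrite -row_free_unit -kermx_eq0; apply/rowV0P => v /sub_kermxP vM.
apply/eqP; apply: contraTT (lexx (0 : F)) => v0; rewrite -ltNge.
have := Mp v^T; rewrite trmxK vM mul0mx mxE; apply.
by apply: contra_neq v0 => /(congr1 trmx); rewrite trmxK trmx0.
Qed.

Lemma pdmx_inv n (M : 'M[F]_n) : pdmx M -> pdmx (invmx M).
Proof.
move=> Mp; have Mu := pdmx_unit Mp; rewrite -(@pdmx_congrE _ M)//.
by rewrite mulmxV// mul1mx Mp.1.
Qed.

Lemma pdmx_block_diag m n (M : 'M[F]_m) (N : 'M[F]_n) :
  pdmx (block_mx M 0 0 N) <-> pdmx M /\ pdmx N.
Proof.
have formE (x : 'cV[F]_m) (y : 'cV[F]_n) :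
    ((col_mx x y)^T *m block_mx M 0 0 N *m col_mx x y) 0 0 =
    (x^T *m M *m x) 0 0 + (y^T *m N *m y) 0 0.
  by rewrite tr_col_mx mul_row_block mul_row_col !mulmx0 addr0 add0r mxE.
split=> [[MNs MNp]|[[Ms Mp] [Ns Np]]].
  move: MNs; rewrite tr_block_mx => /eq_block_mx[Ms _ _ Ns].
  split; split=> // x x0.
    have := MNp (col_mx x 0); rewrite formE mulmx0 [X in _ + X]mxE addr0; apply.
    by rewrite col_mx_eq0 negb_and x0.
  have := MNp (col_mx 0 x); rewrite formE mulmx0 [X in X + _]mxE add0r; apply.
  by rewrite col_mx_eq0 negb_and x0 orbT.
split=> [|x x0]; first by rewrite tr_block_mx Ms Ns !trmx0.
rewrite -(vsubmxK x) formE.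
have M0 (y : 'cV[F]_m) : 0 <= (y^T *m M *m y) 0 0.
  have [->|y0] := eqVneq y 0; first by rewrite mulmx0 mxE.
  exact: ltW (Mp _ y0).
have [u0|u0] := eqVneq (usubmx x) 0; last first.
  rewrite ltr_wpDr// ?Mp//.
  have [->|y0] := eqVneq (dsubmx x) 0; first by rewrite mulmx0 mxE.
  exact: ltW (Np _ y0).
rewrite ltr_wpDl// Np//; apply: contra_neq x0 => d0.
by rewrite -(vsubmxK x) u0 d0 col_mx0.
Qed.

(** Block elimination: the unit lower triangular congruence with block [K *m invmx M] carries the
    block diagonal matrix of [M] and its Schur complement to the full matrix. *)
Lemma pdmx_schur_ul m n (M : 'M[F]_m) (N : 'M[F]_n) (K : 'M[F]_(n, m)) :
  M^T = M -> M \in unitmx ->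
  pdmx (block_mx M K^T K N) <->
  pdmx M /\ pdmx (N - K *m invmx M *m K^T).
Proof.
move=> Ms Mu; rewrite -pdmx_block_diag.
rewrite -(@pdmx_congrE _ (block_mx 1%:M 0 (K *m invmx M) 1%:M)
  (block_mx M 0 0 _)); last by rewrite unitmx_lblock !unitmx1.
rewrite tr_block_mx !mulmx_block trmx_mul trmx_inv Ms !trmx1 trmx0.
rewrite ?(mul1mx, mulmx1, mulmx0, mul0mx, addr0, add0r).
by rewrite mulmxKV// !mulmxA mulmxV// mul1mx addrC subrK.
Qed.

Lemma pdmx_block_sub m n (M : 'M[F]_m) (N : 'M[F]_n) (K : 'M[F]_(m, n)) L :
  pdmx (block_mx M K L N) -> pdmx M /\ pdmx N.
Proof.
move=> [MNs MNp]; move: MNs; rewrite tr_block_mx => /eq_block_mx[Ms _ _ Ns].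
split; split=> // x x0.
  have := MNp (col_mx x 0).
  rewrite tr_col_mx mul_row_block mul_row_col !(trmx0, mul0mx, mulmx0, addr0).
  by apply; rewrite col_mx_eq0 negb_and x0.
have := MNp (col_mx 0 x).
rewrite tr_col_mx mul_row_block mul_row_col !(trmx0, mul0mx, mulmx0, add0r).
by apply; rewrite col_mx_eq0 negb_and x0 orbT.
Qed.

(** With [a], [b], [c] the values of the form at [(y, y)], [(y, x)], [(x, x)], its value at
    [a *: x - b *: y] is nonnegative and equals [a * (a * c - b ^+ 2)], where [a > 0]. *)
Lemma pdmx_cauchy_schwarz n (M : 'M[F]_n) (x y : 'cV[F]_n) : pdmx M ->
  ((y^T *m M *m x) 0 0) ^+ 2 <= (y^T *m M *m y) 0 0 * (x^T *m M *m x) 0 0.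
Proof.
move=> Mp; have [->|y0] := eqVneq y 0.
  by rewrite trmx0 !mul0mx mxE expr0n mul0r.
have yMx : (x^T *m M *m y) 0 0 = (y^T *m M *m x) 0 0.
  by rewrite -[in LHS]Mp.1 -{1}[y]trmxK -!trmx_mul mulmxA mxE.
have yy := Mp.2 _ y0.
set a := (y^T *m M *m y) 0 0 in yy *; set b := (y^T *m M *m x) 0 0.
set c := (x^T *m M *m x) 0 0.
have : 0 <= ((a *: x - b *: y)^T *m M *m (a *: x - b *: y)) 0 0.
  set z := _ - _; have [->|z0] := eqVneq z 0; first by rewrite mulmx0 mxE.
  by apply/ltW/(proj2 Mp).
suff -> : ((a *: x - b *: y)^T *m M *m (a *: x - b *: y)) 0 0 =
    a * (a * c - b ^+ 2) by rewrite pmulr_rge0// subr_ge0.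
have -> : (a *: x - b *: y)^T = a *: x^T - b *: y^T by rewrite linearB /= !linearZ.
rewrite !(mulmxBl, mulmxBr) -!(scalemxAl, scalemxAr).
move: yMx; rewrite /a /b /c; mx_abstract => yMx; rewrite !mxE yMx; ring.
Qed.

(** Cauchy-Schwarz against [invmx M *m delta_mx i 0] bounds each squared coordinate of [x] by a
    multiple of [q x]. Hence the form of [- E] is at most [K * q x] for an explicit [K], and any [e]
    up to [(K + 1)^-1] is admissible. *)
Lemma pdmx_perturb n (M E : 'M[F]_n) : pdmx M -> E^T = E ->
  exists2 d, 0 < d & forall e, 0 <= e <= d -> pdmx (M + e *: E).
Proof.
move=> Mp Es; have Mu := pdmx_unit Mp.
pose q (x : 'cV[F]_n) := (x^T *m M *m x) 0 0.
pose k i := q (invmx M *m delta_mx i 0).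
have xk (x : 'cV[F]_n) i : (x i 0) ^+ 2 <= k i * q x.
  have := pdmx_cauchy_schwarz x (invmx M *m delta_mx i 0) Mp.
  rewrite [X in X ^+ 2](_ : _ = x i 0)//.
  rewrite trmx_mul trmx_inv Mp.1 mulmxKV// trmx_delta mxE (bigD1 i)//= mxE !eqxx.
  rewrite mul1r big1 ?addr0// => j ji; rewrite mxE (negbTE ji) andbF mul0r//.
have q0 x : 0 <= q x.
  have [->|x0] := eqVneq x 0; first by rewrite /q mulmx0 mxE.
  by apply/ltW/(proj2 Mp).
have k0 i : 0 <= k i := q0 _.
pose K := \sum_j \sum_i `|E i j| * (k i + k j).
have K0 : 0 <= K.
  apply/sumr_ge0 => j _; apply/sumr_ge0 => i _.
  by rewrite mulr_ge0 ?addr_ge0.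
have EK x : - (x^T *m E *m x) 0 0 <= K * q x.
  rewrite mxE -sumrN mulr_suml; apply: ler_sum => j _.
  rewrite mxE mulr_suml -sumrN mulr_suml; apply: ler_sum => i _; rewrite mxE.
  rewrite (le_trans (ler_norm _))// normrN mulrAC [_ * E i j]mulrC normrM -mulrA.
  rewrite ler_wpM2l// mulrDl.
  apply: (@le_trans _ _ (x i 0 ^+ 2 + x j 0 ^+ 2)); last exact: lerD.
  by rewrite ler_norml; apply/andP; split; nra.
exists (K + 1)^-1; first by rewrite invr_gt0 ltr_wpDl.
move=> e /andP[e0]; rewrite -[_^-1]mul1r ler_pdivlMr ?ltr_wpDl// => eK.
split=> [|x x0]; first by rewrite linearD linearZ /= Mp.1 Es.
rewrite mulmxDr mulmxDl -scalemxAr -scalemxAl mxE [X in _ + X]mxE.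
have := Mp.2 _ x0; rewrite -/(q x) => qx; have := EK x.
set r := (x^T *m E *m x) 0 0 => rK.
have [->|en] := eqVneq e 0; first by rewrite mul0r addr0.
have e1 : 0 < e by rewrite lt_def en.
nra.
Qed.

End PositiveDefinite.

(** * Lyapunov's criterion for stability *)

Section Lyapunov.
Context {F : realType}.

Lemma eigenvalue_Re_Im n (M : 'M[F]_n) (z : F[i]%C) :
  eigenvalue (map_mx (real_complex F) M) z ->
  exists a b : 'rV[F]_n, [/\ (a != 0) || (b != 0),
    a *m M = complex.Re z *: a - complex.Im z *: b &
    b *m M = complex.Im z *: a + complex.Re z *: b].
Proof.
move=> /eigenvalueP[v vM v0].
exists (map_mx (@complex.Re F) v), (map_mx (@complex.Im F) v); split.
- apply: contra_neqT v0; rewrite negb_or !negbK => /andP[/eqP Re0 /eqP Im0].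
  apply/matrixP => i j; apply/eqP; rewrite eq_complex mxE /=.
  move: (congr1 (fun A : 'rV_n => A i j) Re0) (congr1 (fun A : 'rV_n => A i j) Im0).
  by rewrite !mxE => -> ->; rewrite eqxx.
- apply/matrixP => i j; rewrite !mxE.
  have := congr1 (fun A : 'rV_n => complex.Re (A i j)) vM; rewrite !mxE /=.
  rewrite (big_morph (@complex.Re F) (id1 := 0) (op1 := +%R)) => [|[? ?] [? ?]//|//].
  have -> : complex.Re (z * v i j) = complex.Re z * complex.Re (v i j)
      - complex.Im z * complex.Im (v i j) by case: (z); case: (v i j).
  move=> <-; apply: eq_bigr => k _; rewrite !mxE.
  by case: (v i k) => x y /=; rewrite mulr0 subr0.
- apply/matrixP => i j; rewrite !mxE.
  have := congr1 (fun A : 'rV_n => complex.Im (A i j)) vM; rewrite !mxE /=.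
  rewrite (big_morph (@complex.Im F) (id1 := 0) (op1 := +%R)) => [|[? ?] [? ?]//|//].
  have -> : complex.Im (z * v i j) = complex.Im z * complex.Re (v i j)
      + complex.Re z * complex.Im (v i j).
    by case: (z) => ? ?; case: (v i j) => ? ? /=; rewrite addrC.
  move=> <-; apply: eq_bigr => k _; rewrite !mxE.
  by case: (v i k) => x y /=; rewrite mulr0 add0r.
Qed.

(** Let [a] and [b] be the real and imaginary parts of a row eigenvector. When the forms at [a] and
    [b] are added, the [Im z] terms cancel by symmetry of [P], leaving [-2 Re z] times a positive
    number. *)
Lemma lyapunov_stable n (M P : 'M[F]_n) :
  pdmx P -> pdmx (- (M *m P + P *m M^T)) -> stable M.
Proof.
move=> Pp Lp z /eigenvalue_Re_Im[a [b [ab0 aM bM]]].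
set x := complex.Re z in aM bM *; set y := complex.Im z in aM bM.
pose q S (u : 'rV[F]_n) := (u *m S *m u^T) 0 0.
have q_gt0 S u : pdmx S -> u != 0 -> 0 < q S u.
  move=> [_ Sp] u0; have := Sp u^T; rewrite trmxK; apply.
  by apply: contra_neq u0 => /(congr1 trmx); rewrite trmxK trmx0.
have q_ge0 S u : pdmx S -> 0 <= q S u.
  move=> Sp; have [->|u0] := eqVneq u 0; first by rewrite /q !mul0mx mxE.
  exact/ltW/q_gt0.
have {}q_gt0 S : pdmx S -> 0 < q S a + q S b.
  move=> Sp; case/orP: ab0 => /(q_gt0 _ _ Sp) ?.
    by rewrite ltr_wpDr ?q_ge0.
  by rewrite ltr_wpDl ?q_ge0.
have := q_gt0 _ Lp; have := q_gt0 _ Pp.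
have sym (u v : 'rV[F]_n) : u *m P *m v^T = v *m P *m u^T.
  rewrite -[LHS]trmxK [LHS]mx11_scalar [RHS]mx11_scalar; congr (_%:M).
  by rewrite mxE !trmx_mul trmxK Pp.1 mulmxA mxE.
have qL u : q (- (M *m P + P *m M^T)) u = - 2 * ((u *m M) *m P *m u^T) 0 0.
  rewrite /q mulmxN mulNmx mulmxDr mulmxDl !mulmxA -(mulmxA _ M^T) -trmx_mul.
  rewrite (sym u (u *m M)); mx_abstract; rewrite !mxE; ring.
rewrite !qL aM bM /q !(mulmxDl, mulNmx) -!scalemxAl (sym b a).
mx_abstract; rewrite !mxE => pP pL.
nra.
Qed.

Lemma stable_real_eigenvalue n (M : 'M[F]_n) a :
  stable M -> eigenvalue M a -> a < 0.
Proof. by move=> Ms Ma; apply: (Ms (real_complex F a)); rewrite eigenvalue_map. Qed.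

Lemma eigenvalue_unitmx (K : fieldType) n (M : 'M[K]_n) a :
  eigenvalue M a = (M - a%:M \notin unitmx).
Proof. by rewrite /eigenvalue /eigenspace kermx_eq0 row_free_unit. Qed.

(* A real eigenvector, or the real and imaginary parts of a complex one, span
   an invariant subspace on which [M] acts with symmetric part [a / 2 < 0]. *)
Lemma stable_invariant_subspace n (M : 'M[F]_n) : (0 < n)%N -> stable M ->
  exists k a (V : 'M[F]_(k.+1, n)) (N : 'M[F]_k.+1),
    [/\ row_free V, V *m M = N *m V, N + N^T = a%:M & a < 0].
Proof.
move=> n0 Ms; have [[a Ma]|noeig] := pselect (exists a, eigenvalue M a).
  have a0 := stable_real_eigenvalue Ms Ma.
  have /eigenvalueP[v vM v0] := Ma.
  exists 0%N, (a + a), v, a%:M; split.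
  - by rewrite /row_free rank_rV v0.
  - by rewrite vM mul_scalar_mx.
  - by rewrite tr_scalar_mx raddfD.
  - by rewrite -mulr2n pmulrn_llt0.
have [z Mz] := eigenvalue_closed (map_mx (real_complex F) M) n0.
have z0 := Ms _ Mz; have [a [b [ab0 aM bM]]] := eigenvalue_Re_Im Mz.
set x := complex.Re z in z0 aM bM; set y := complex.Im z in aM bM.
pose V := col_mx a b : 'M[F]_(1 + 1, n).
pose N := block_mx x%:M (- (y%:M)) y%:M x%:M : 'M[F]_(1 + 1).
have VM : V *m M = N *m V.
  by rewrite mul_col_mx aM bM mul_block_col mulNmx !mul_scalar_mx.
have NN : N + N^T = (x + x)%:M.
  rewrite tr_block_mx linearN /= !tr_scalar_mx add_block_mx addNr subrr.
  by rewrite [RHS]scalar_mx_block !raddfD.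
exists 1%N, (x + x), V, N; split=> //; last by rewrite -mulr2n pmulrn_llt0.
(* If [V] were not free, its rows would span an invariant line, hence a real eigenvector. *)
apply: contra_notT noeig => Vfree.
have V0 : V != 0 by rewrite col_mx_eq0 negb_and.
pose r := nz_row V; have rV : (r <= V)%MS by exact: nz_row_sub.
have r0 : r != 0 by rewrite nz_row_eq0.
have Vr : (V <= r)%MS.
  rewrite -(geq_leqif (mxrank_leqif_sup rV)) rank_rV r0.
  by move: Vfree (rank_leq_row V); rewrite /row_free leq_eqVlt => /negPf->.
have /sub_rVP[l rM] : (r *m M <= r)%MS.
  by apply: submx_trans Vr; rewrite (submx_trans (submxMr _ rV))// VM submxMl.
by exists l; apply/eigenvalueP; exists r.
Qed.

Lemma lyapunov_similar n (U M P : 'M[F]_n) : U \in unitmx ->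
  (U *m M *m invmx U) *m (U *m P *m U^T) +
  (U *m P *m U^T) *m (U *m M *m invmx U)^T = U *m (M *m P + P *m M^T) *m U^T.
Proof.
move=> Uu; rewrite !trmx_mul mulmxDr mulmxDl !mulmxA mulmxKV//.
by rewrite -(mulmxA _ U^T (invmx U)^T) -trmx_mul mulVmx// trmx1 mulmx1.
Qed.

(** Induction on the dimension. In a basis that starts with an invariant subspace, [M] becomes block
    lower triangular with blocks [N], [c], [d]. The certificate is a small multiple of the identity
    on the subspace, where the symmetric part of [N] is a negative scalar, next to the certificate
    of [d]. *)
Lemma stable_lyapunov n (M : 'M[F]_n) : stable M ->
  exists2 P, pdmx P & pdmx (- (M *m P + P *m M^T)).
Proof.
have [k] := ubnP n; elim: k n M => // k IH [|n] M nk Ms.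
  by exists 0; split=> [|x]; rewrite ?flatmx0 ?eqxx//; apply/matrixP=> -[].
have [j [a [V [N [Vfree VM Na a0]]]]] := stable_invariant_subspace (ltn0Sn n) Ms.
have jn : (j.+1 <= n.+1)%N by rewrite -(eqP Vfree) rank_leq_col.
have [m nE] : exists m, n.+1 = (j.+1 + m)%N by exists (n.+1 - j.+1)%N; rewrite subnKC.
move: n.+1 nE => n' nE in nk jn M Ms V Vfree VM *; subst n'.
(* A completion of the rows of [V] to a basis: since [V] has full row rank, it is [col_ebase V]
   times the top rows of [row_ebase V]. *)
pose U := block_mx (col_ebase V) 0 0 1%:M *m row_ebase V.
have Uu : U \in unitmx.
  by rewrite unitmx_mul row_ebase_unit unitmx_lblock col_ebase_unit unitmx1.
have UV : usubmx U = V.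
  rewrite -mul_usub_mx block_mxEv col_mxKu -[RHS]mulmx_ebase (eqP Vfree) pid_mx_row.
  by rewrite mul_mx_row mulmx1 mulmx0.
clearbody U; pose B := U *m M *m invmx U.
have BE : B = block_mx N 0 (dlsubmx B) (drsubmx B).
  rewrite -[LHS]submxK; congr block_mx.
  - rewrite /ulsubmx -!mul_usub_mx UV VM -UV -mulmxA mul_usub_mx mulmxV//.
    by rewrite (scalar_mx_block _ _ 1) block_mxEv col_mxKu mul_mx_row row_mxKl mulmx1.
  - rewrite /ursubmx -!mul_usub_mx UV VM -UV -mulmxA mul_usub_mx mulmxV//.
    by rewrite (scalar_mx_block _ _ 1) block_mxEv col_mxKu mul_mx_row row_mxKr mulmx0.
set c := dlsubmx B in BE; set d := drsubmx B in BE.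
have ME : M = invmx U *m B *m invmx (invmx U).
  by rewrite invmxK !mulmxA mulVmx// mul1mx mulmxKV.
(* If [M - z] is invertible then so is the block triangular [B - z], hence also its diagonal block
   [d - z]. *)
have ds : stable d.
  move=> z dz; apply: Ms; move: dz; rewrite !eigenvalue_unitmx.
  apply: contra => Mz; have : map_mx (real_complex F) B - z%:M \in unitmx.
    have -> : map_mx (real_complex F) B - z%:M =
        map_mx (real_complex F) U *m (map_mx (real_complex F) M - z%:M) *m
        map_mx (real_complex F) (invmx U).
      rewrite mulmxBr mulmxBl -!map_mxM -/B mul_mx_scalar -scalemxAl -map_mxM.
      by rewrite mulmxV// map_mx1 scalemx1.
    by rewrite !unitmx_mul !map_unitmx unitmx_inv Uu Mz.
  rewrite BE map_block_mx scalar_mx_block opp_block_mx add_block_mx map_mx0.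
  by rewrite subr0 unitmx_lblock => /andP[].
have [|P Pp Lp] := IH m d _ ds.
  by move: nk; rewrite ltnS addSn; apply: leq_trans; rewrite ltnS leq_addl.
have [|e e0 /(_ e)] := @pdmx_perturb _ _ _ (- (c *m c^T)) Lp.
  by rewrite linearN /= trmx_mul trmxK.
rewrite lexx ltW// => /(_ isT) pert.
(* This weight makes the Schur correction [del ^+ 2 / (del * - a)] times [c *m c^T] equal to the
   tolerated perturbation [e *: (c *m c^T)]. *)
pose del := - a * e; have del0 : 0 < del by rewrite mulr_gt0 ?oppr_gt0.
pose P0 := block_mx del%:M 0 0 P : 'M[F]_(j.+1 + m).
have P0p : pdmx P0 by apply/pdmx_block_diag; split=> //; exact: pdmx_scalar.
have iUu : invmx U \in unitmx by rewrite unitmx_inv.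
exists (invmx U *m P0 *m (invmx U)^T); first exact: pdmx_congr.
clearbody B; rewrite ME lyapunov_similar// -mulNmx -mulmxN; apply: pdmx_congr => //.
have -> : - (B *m P0 + P0 *m B^T) =
    block_mx (del * - a)%:M (- del *: c)^T (- del *: c) (- (d *m P + P *m d^T)).
  rewrite BE tr_block_mx !mulmx_block !(mulmx0, mul0mx, trmx0, addr0, add0r).
  rewrite !(mul_mx_scalar, mul_scalar_mx) add_block_mx opp_block_mx add0r addr0.
  rewrite -scalerDr Na -[a%:M]scalemx1 scalerA -scaleNr scalemx1 mulrN
    [(- del *: c)^T]linearZ /=.
  by rewrite !scaleNr.
have dela : 0 < del * - a by rewrite mulr_gt0 ?oppr_gt0.
apply/pdmx_schur_ul; first by rewrite tr_scalar_mx.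
  exact: pdmx_unit (pdmx_scalar _ dela).
split; first exact: pdmx_scalar.
suff <- : e *: - (c *m c^T) =
    - (- del *: c *m invmx (del * - a)%:M *m (- del *: c)^T) by [].
rewrite invmx_scalar mul_mx_scalar [(- del *: c)^T]linearZ /=.
rewrite -!(scalemxAl, scalemxAr) !scalerA scalerN; congr (- (_ *: _)).
rewrite /del; field; by rewrite lt_eqF ?gt_eqF.
Qed.

End Lyapunov.

(** * Limits of matrix-valued functions *)

Section MatrixLimits.
Context {F : realType} {T : Type} {G : set_system T} {FG : Filter G}.

Lemma cvg_mxP m n (f : T -> 'M[F]_(m, n)) (M : 'M[F]_(m, n)) :
  f @ G --> M <-> forall i j, f s i j @[s --> G] --> M i j.
Proof.
split=> [fM i j|fM]; first exact: cvg_comp fM (@coord_continuous _ _ _ _ _ _).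
move=> A [P MP PA]; rewrite /nbhs /=.
have : \forall s \near G, forall i j, P i j (f s i j).
  by apply: filter_forall => i; apply: filter_forall => j; exact/fM/MP.
by apply: filterS => s ?; exact: PA.
Qed.

Lemma cvg_mulmx m n p (f : T -> 'M[F]_(m, n)) (g : T -> 'M[F]_(n, p))
    (M : 'M[F]_(m, n)) (N : 'M[F]_(n, p)) :
  f @ G --> M -> g @ G --> N -> f s *m g s @[s --> G] --> M *m N.
Proof.
move=> /cvg_mxP fM /cvg_mxP gN; apply/cvg_mxP => i j.
under eq_fun do rewrite mxE; rewrite mxE.
by apply: cvg_big => [|k _]; [exact: add_continuous|exact: cvgM].
Qed.

Lemma cvg_block_mx m1 m2 n1 n2 (f : T -> 'M[F]_(m1, n1)) (g : T -> 'M[F]_(m1, n2))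
    (h : T -> 'M[F]_(m2, n1)) (k : T -> 'M[F]_(m2, n2))
    (M : 'M[F]_(m1, n1)) (N : 'M[F]_(m1, n2))
    (O : 'M[F]_(m2, n1)) (P : 'M[F]_(m2, n2)) :
  f @ G --> M -> g @ G --> N -> h @ G --> O -> k @ G --> P ->
  block_mx (f s) (g s) (h s) (k s) @[s --> G] --> block_mx M N O P.
Proof.
move=> /cvg_mxP fM /cvg_mxP gN /cvg_mxP hO /cvg_mxP kP; apply/cvg_mxP => i j.
rewrite !mxE; under eq_fun do rewrite !mxE.
case: (fintype.split i) => i'; rewrite !mxE; under eq_fun do rewrite !mxE;
  case: (fintype.split j) => j'; [exact: fM|exact: gN|exact: hO|exact: kP].
Qed.

Lemma cvg_det n (f : T -> 'M[F]_n) (M : 'M[F]_n) :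
  f @ G --> M -> \det (f s) @[s --> G] --> \det M.
Proof.
move=> /cvg_mxP fM; apply: cvg_big => [|s _]; first exact: add_continuous.
apply: cvgM; first exact: cvg_cst.
by apply: cvg_big => [|i _]; [exact: mul_continuous|exact: fM].
Qed.

(** The adjugate formula holds only at invertible matrices, but these form a neighbourhood of [M]
    because the determinant is continuous. *)
Lemma cvg_invmx n (f : T -> 'M[F]_n) (M : 'M[F]_n) : M \in unitmx ->
  f @ G --> M -> invmx (f s) @[s --> G] --> invmx M.
Proof.
move=> Mu fM; have detM := cvg_det fM.
have fu : \forall s \near G, f s \in unitmx.
  move: Mu; rewrite unitmxE unitfE => /(cvgr_neq0 _ detM).
  by apply: filterS => s; rewrite unitmxE unitfE.
have adjE N : N \in unitmx -> invmx N = (\det N)^-1 *: \adj N.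
  by move=> Nu; rewrite /invmx Nu.
rewrite adjE//; apply: (@cvg_trans _ ((\det (f s))^-1 *: \adj (f s) @[s --> G])).
  by apply: near_eq_cvg; apply: filterS fu => s fs; rewrite adjE.
apply: cvgZ; first by apply: cvgV => //; move: Mu; rewrite unitmxE unitfE.
apply/cvg_mxP => i j; rewrite mxE; under eq_fun do rewrite mxE.
apply: cvgM; first exact: cvg_cst.
apply: cvg_det; move/cvg_mxP : fM => fM; apply/cvg_mxP => k l.
rewrite !mxE; under eq_fun do rewrite !mxE; exact: fM.
Qed.

End MatrixLimits.

(** * Path-joinedness and path components *)

Section Paths.
Context {F : realType}.

Lemma within_continuous_reparam (T : topologicalType) (A B : set F)
    (f : F -> T) (g : F -> F) : continuous g -> (forall x, A x -> B (g x)) ->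
  {within B, continuous f} -> {within A, continuous (f \o g)}.
Proof.
move=> gc AB /subspace_continuousP fc; apply/subspace_continuousP => x Ax.
apply: (@cvg_comp _ _ _ g f _ (within B (nbhs (g x)))); last exact/fc/AB.
move=> P PB; have {}PB : \forall s \near x, B (g s) -> P (g s) := gc x _ PB.
change (\forall s \near x, A s -> P (g s)).
by apply: filterS PB => s + As; apply; exact: AB.
Qed.

Lemma path_joinedP (T : topologicalType) (S : set T) (f : F -> T) :
  (forall t : F, 0 <= t <= 1 -> S (f t)) ->
  (forall t : F, 0 <= t <= 1 -> f s @[s --> within `[0, 1] (nbhs t)] --> f t) ->
  path_joined F S (f 0) (f 1).
Proof.
move=> Sf cf; exists f; split=> //.
  by apply/subspace_continuousP => t; rewrite /= in_itv; exact: cf.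
by move=> _ [t /= + <-]; rewrite in_itv; exact: Sf.
Qed.

Lemma path_joined_refl (T : topologicalType) (S : set T) x :
  S x -> path_joined F S x x.
Proof.
by move=> Sx; apply: (@path_joinedP _ _ (fun=> x)) => // t _; exact: cvg_cst.
Qed.

Lemma path_joined_sym (T : topologicalType) (S : set T) x y :
  path_joined F S x y -> path_joined F S y x.
Proof.
move=> [f [fc f0 f1 fS]]; exists (f \o (fun t => 1 - t)); split => /=.
- apply: within_continuous_reparam fc.
    by move=> t; apply: cvgB; [exact: cvg_cst|exact: cvg_id].
  by move=> t; rewrite /= !in_itv /=; lra.
- by rewrite subr0.
- by rewrite subrr.
move=> _ [t /= t01 <-]; apply: fS; exists (1 - t) => //.
by move: t01; rewrite /= !in_itv /=; lra.
Qed.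

Lemma path_joined_trans (T : topologicalType) (S : set T) y x z :
  path_joined F S x y -> path_joined F S y z -> path_joined F S x z.
Proof.
move=> [f [fc f0 f1 fS]] [g [gc g0 g1 gS]].
pose h t := if t <= 2^-1 then f (2 * t) else g (2 * t - 1).
have affine_cts a b : continuous (fun t : F => a * t - b).
  move=> t; apply: cvgB; last exact: cvg_cst.
  by apply: cvgM; [exact: cvg_cst|exact: cvg_id].
have half2 : 2 * 2^-1 = 1 :> F by rewrite divff.
(* The [- 0] gives both halves the shape covered by [affine_cts]. *)
have hfE t : t <= 2^-1 -> h t = f (2 * t - 0) by rewrite /h subr0 => ->.
have hgE t : 2^-1 <= t -> h t = g (2 * t - 1).
  rewrite /h le_eqVlt => /predU1P[<-|]; first by rewrite lexx half2 subrr f1 g0.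
  by rewrite ltNge => /negPf ->.
exists h; split.
- have -> : `[0, 1]%classic = `[0, 2^-1]%classic `|` `[2^-1, 1]%classic :> set F.
    apply/seteqP; split=> t /=; rewrite !in_itv /=; last by lra.
    by case: (leP t 2^-1) => ? ?; [left|right]; lra.
  apply: withinU_continuous; [exact: interval_closed..| |].
    apply: (@subspace_eq_continuous _ _ _ (f \o (fun t => 2 * t - 0))).
      by move=> t; rewrite inE /= in_itv /= => /andP[_ ?]; rewrite /from_subspace hfE.
    apply: within_continuous_reparam fc => // t; rewrite /= !in_itv /=; lra.
  apply: (@subspace_eq_continuous _ _ _ (g \o (fun t => 2 * t - 1))).
    by move=> t; rewrite inE /= in_itv /= => /andP[? _]; rewrite /from_subspace hgE.
  apply: within_continuous_reparam gc => // t; rewrite /= !in_itv /=; lra.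
- by rewrite hfE ?mulr0 ?subr0.
- by rewrite hgE ?mulr1 -?[2 - 1]/(1 + 1 - 1) ?addrK// invf_le1 ?ler1n.
move=> _ [t /= + <-]; rewrite in_itv /= => t01.
have [t2|t2] := leP t 2^-1.
  by rewrite hfE//; apply: fS; exists (2 * t - 0) => //=; rewrite in_itv /=; lra.
rewrite hgE ?ltW//; apply: gS; exists (2 * t - 1) => //=; rewrite in_itv /=; lra.
Qed.

(** Continuity is asked only on [S], since the maps applied later involve [invmx] and are controlled
    only at invertible matrices. *)
Lemma path_joined_map (T T' : topologicalType) (S : set T) (S' : set T')
    (phi : T -> T') x y :
  (forall z, S z -> {for z, continuous phi}) -> (forall z, S z -> S' (phi z)) ->
  path_joined F S x y -> path_joined F S' (phi x) (phi y).
Proof.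
move=> phic SS' [f [/subspace_continuousP fc <- <- fS]].
apply: (@path_joinedP _ _ (phi \o f)) => t t01.
  by apply/SS'/fS; exists t => //=; rewrite in_itv.
apply: (cvg_comp _ _ (fc t _) (phic _ _)); first by rewrite /= in_itv.
by apply: fS; exists t => //=; rewrite in_itv.
Qed.

Lemma path_joined_segment m n (S : set 'M[F]_(m, n)) x y :
  (forall t : F, 0 <= t <= 1 -> S ((1 - t) *: x + t *: y)) -> path_joined F S x y.
Proof.
move=> Sxy; have := @path_joinedP _ S (fun t => (1 - t) *: x + t *: y) Sxy.
rewrite subr0 scale1r scale0r addr0 subrr scale0r scale1r add0r; apply=> t _.
apply: cvgD; apply: cvgZ; try exact: cvg_cst.
  by apply: cvgB; [exact: cvg_cst|exact: cvg_within].
exact: cvg_within.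
Qed.

(** Joined points have equal components, so every component is one of the two values of [D]. *)
Lemma path_components_le2 (T : topologicalType) (S : set T) c0 c1 :
  (forall x, S x -> path_joined F S x c0 \/ path_joined F S x c1) ->
  path_components F S #<= `I_2.
Proof.
move=> Sc; have pcE x c : path_joined F S x c ->
    path_component F S x = path_component F S c.
  move=> xc; apply/seteqP; split=> y /=; apply: path_joined_trans => //.
  exact: path_joined_sym.
pose D (k : nat) := path_component F S (if k == 0 then c0 else c1).
apply: card_le_trans (card_image_le D `I_2).
apply: subset_card_le => _ [x Sx <-].
by case: (Sc x Sx) => /pcE ->; [exists 0|exists 1].
Qed.

End Paths.

(** * Paths of invertible matrices with a given determinant sign *)

Section GeneralLinearGroup.
Context {F : realType}.

Local Notation GL n := [set M : 'M[F]_n | M \in unitmx].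

Lemma path_joined_GL_lmul n (E M : 'M[F]_n) :
  (forall t, 1%:M + t *: E \in unitmx) -> M \in unitmx ->
  path_joined F (GL n) M ((1%:M + E) *m M).
Proof.
move=> Eu Mu; apply: path_joined_segment => t _ /=.
have -> : (1 - t) *: M + t *: ((1%:M + E) *m M) = (1%:M + t *: E) *m M.
  by mx_ring.
by rewrite unitmx_mul Eu.
Qed.

Lemma transvection_ldl m n (L : 'M[F]_(n, m)) (M : 'M[F]_(m + n)) :
  M \in unitmx -> path_joined F (GL (m + n)) M (block_mx 1%:M 0 L 1%:M *m M).
Proof.
move=> Mu; have -> : block_mx 1%:M 0 L 1%:M =
    1%:M + block_mx 0 0 L 0 :> 'M[F]_(m + n).
  by rewrite scalar_mx_block add_block_mx !addr0 add0r.
apply: path_joined_GL_lmul => // t.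
rewrite scale_block_mx !scaler0 scalar_mx_block add_block_mx !addr0 add0r.
by rewrite unitmxE det_lblock !det1 mulr1 unitr1.
Qed.

Lemma transvection_dur m n (L : 'M[F]_(m, n)) (M : 'M[F]_(m + n)) :
  M \in unitmx -> path_joined F (GL (m + n)) M (block_mx 1%:M L 0 1%:M *m M).
Proof.
move=> Mu; have -> : block_mx 1%:M L 0 1%:M =
    1%:M + block_mx 0 L 0 0 :> 'M[F]_(m + n).
  by rewrite scalar_mx_block add_block_mx !addr0 add0r.
apply: path_joined_GL_lmul => // t.
rewrite scale_block_mx !scaler0 scalar_mx_block add_block_mx !addr0 add0r.
by rewrite unitmxE det_ublock !det1 mulr1 unitr1.
Qed.

(* Row transvections are joined to the identity; a few of them turn the corner
   entry into [1] and clear the first column and row. *)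
Lemma GL_reduce n (M : 'M[F]_(1 + n.+1)) : M \in unitmx ->
  exists2 S : 'M[F]_n.+1, \det S = \det M &
    path_joined F (GL (1 + n.+1)) M (block_mx 1%:M 0 0 S).
Proof.
have detL (L : 'M[F]_(n.+1, 1)) N : \det (block_mx 1%:M 0 L 1%:M *m N) = \det N.
  by rewrite det_mulmx det_lblock !det1 !mul1r.
have detU (L : 'M[F]_(1, n.+1)) N : \det (block_mx 1%:M L 0 1%:M *m N) = \det N.
  by rewrite det_mulmx det_ublock !det1 !mul1r.
have unitL (L : 'M[F]_(n.+1, 1)) N : N \in unitmx ->
    block_mx 1%:M 0 L 1%:M *m N \in unitmx.
  by rewrite !unitmxE detL.
have unitU (L : 'M[F]_(1, n.+1)) N : N \in unitmx ->
    block_mx 1%:M L 0 1%:M *m N \in unitmx.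
  by rewrite !unitmxE detU.
have step1 (b : 'M[F]_(1, n.+1)) (c : 'M[F]_(n.+1, 1)) (d : 'M[F]_n.+1) :
    block_mx 1%:M b c d \in unitmx -> exists2 S : 'M[F]_n.+1,
      \det S = \det (block_mx 1%:M b c d) &
      path_joined F (GL (1 + n.+1)) (block_mx 1%:M b c d) (block_mx 1%:M 0 0 S).
  (* Clearing [c] leaves the Schur complement [S], which has the same determinant and is thus
     invertible; [- b *m invmx S] then clears [b]. *)
  move=> Nu; pose S := d - c *m b.
  have LE : block_mx 1%:M 0 (- c) 1%:M *m block_mx 1%:M b c d = block_mx 1%:M b 0 S.
    rewrite mulmx_block !(mul1mx, mul0mx, mulmx1, addr0) addNr mulNmx.
    by rewrite [- _ + _]addrC.
  have detS : \det S = \det (block_mx 1%:M b c d).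
    by rewrite -(detL (- c)) LE det_ublock det1 mul1r.
  have Su : S \in unitmx by rewrite unitmxE detS -unitmxE.
  exists S => //; apply: path_joined_trans (transvection_ldl (- c) Nu) _.
  have := transvection_dur (- b *m invmx S) (unitL (- c) _ Nu).
  rewrite LE [X in path_joined _ _ _ X](_ : _ = block_mx 1%:M 0 0 S)//.
  rewrite mulmx_block !(mul1mx, mul0mx, mulmx1, mulmx0, addr0, add0r).
  by rewrite mulmxKV// subrr.
have step2 a (b : 'M[F]_(1, n.+1)) (c : 'M[F]_(n.+1, 1)) (d : 'M[F]_n.+1) : c != 0 ->
    block_mx a b c d \in unitmx -> exists2 S : 'M[F]_n.+1,
      \det S = \det (block_mx a b c d) &
      path_joined F (GL (1 + n.+1)) (block_mx a b c d) (block_mx 1%:M 0 0 S).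
  move=> c0 Nu.
  (* Adding [v] times the lower rows to the first row turns the corner [a] into [1]. *)
  have [v vc] : exists v : 'M[F]_(1, n.+1), v *m c = 1%:M - a.
    have /cV0Pn[i ci] := c0.
    exists (((1%:M - a) 0 0 / c i 0) *: delta_mx 0 i).
    by apply/matrixP => k l; rewrite !ord1 -scalemxAl -rowE !mxE divfK.
  have UE : block_mx 1%:M v 0 1%:M *m block_mx a b c d =
      block_mx 1%:M (b + v *m d) c d.
    by rewrite mulmx_block !(mul1mx, mul0mx, add0r) vc addrC subrK.
  have := unitU v _ Nu; rewrite UE => /step1[S dS S_]; exists S.
    by rewrite dS -UE detU.
  by apply: path_joined_trans S_; rewrite -UE; exact: transvection_dur.
rewrite -(submxK M); move: (ulsubmx M) (ursubmx M) (dlsubmx M) (drsubmx M).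
move=> a b c d Nu; have [c0|c0] := eqVneq c 0; last by apply: (step2 a b c d c0).
have a0 : a 0 0 != 0.
  move: Nu; rewrite c0 unitmxE det_ublock unitrM => /andP[+ _].
  by rewrite {1}[a]mx11_scalar det_scalar1 unitfE.
(* When [c = 0] the corner is nonzero; adding the first row to all the others makes the column below
   it nonzero, which leads back to [step2]. *)
pose w : 'M[F]_(n.+1, 1) := const_mx 1.
have LE : block_mx 1%:M 0 w 1%:M *m block_mx a b c d =
    block_mx a b (w *m a) (w *m b + d).
  by rewrite mulmx_block c0 !(mul1mx, mul0mx, addr0).
have := unitL w _ Nu; rewrite LE => /step2[|S dS S_].
  apply: contra_neq a0 => /matrixP/(_ 0 0).
  by rewrite !mxE big_ord1 mxE mul1r.
exists S; first by rewrite dS -LE detL.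
by apply: path_joined_trans S_; rewrite -LE; exact: transvection_ldl.
Qed.

(** Induction on the size: [GL_reduce] removes one dimension from both matrices and keeps their
    determinants. In size one, a segment between two reals of the same sign avoids zero. *)
Lemma GL_path_joined n (M N : 'M[F]_n) :
  0 < \det M * \det N -> path_joined F (GL n) M N.
Proof.
elim: n M N => [|[|n] IH] M N MN.
- rewrite [N]thinmx0 [M]thinmx0; apply: path_joined_refl.
  by rewrite /= unitmxE det_mx00 unitr1.
- apply: path_joined_segment => t t01 /=; rewrite unitmxE unitfE det_mx11.
  move: MN; rewrite !det_mx11 !mxE.
  set x := M 0 0; set y := N 0 0 => xy.
  have [x0|x0|x0] := ltgtP x 0.
  - have y0 : y < 0 by nra.
    by rewrite lt_eqF//; nra.
  - have y0 : 0 < y by nra.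
    by rewrite gt_eqF//; nra.
  - by move: xy; rewrite x0 mul0r ltxx.
have [Mu Nu] : M \in unitmx /\ N \in unitmx.
  rewrite !unitmxE !unitfE; apply/andP; rewrite -negb_or -mulf_eq0.
  by rewrite gt_eqF.
have [S dS MS] := @GL_reduce n M Mu; have [T dT NT] := @GL_reduce n N Nu.
apply: path_joined_trans MS _; apply: path_joined_trans (path_joined_sym NT).
apply: (@path_joined_map _ _ _ (GL n.+1) (GL (1 + n.+1)) 
  (fun S : 'M[F]_n.+1 => block_mx (1%:M : 'M[F]_1) 0 0 S)).
- by move=> A _; apply: (@cvg_block_mx _ _ (nbhs A)); [exact: cvg_cst..|exact: cvg_id].
- by move=> A /= Au; rewrite unitmx_lblock unitmx1.
- by apply: IH; rewrite dS dT.
Qed.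

End GeneralLinearGroup.

(** * Convex parametrization of certified controllers *)

Section Controllers.
Context {F : realType} {n m p : nat}.
Variables (A : 'M[F]_n) (B : 'M[F]_(n, m)) (C : 'M[F]_(p, n)).
Implicit Types (S Z X Y N T : 'M[F]_n) (K G : 'M[F]_(m, n)) (L H : 'M[F]_(n, p)).

Definition closed_loop K L N : 'M[F]_(n + n) :=
  block_mx A (B *m K) (L *m C) N.

(** Suffix [e] refers to the estimation error, [x] to the plant state; [S] and [Z] are the
    covariances of the error and of the controller state. These two are uncorrelated, so [lyap_ee]
    involves neither [K] nor [N]. *)
Definition lyap_ee S L := (A - L *m C) *m S + S *m (A - L *m C)^T.
Definition lyap_ex X K L N Z S :=
  A *m X + B *m K *m Z + S *m A^T - L *m C *m X - N *m Z.
Definition lyap_xx X K Z := (A *m X + B *m K *m Z) + (A *m X + B *m K *m Z)^T.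

(* In the coordinates (x - xi, x), where xi is the controller state, the
   covariance becomes block diagonal and the Lyapunov matrix takes this form. *)
Lemma closed_loop_lyapunovE S Z K L N (P := block_mx (S + Z) Z Z Z)
    (J := block_mx 1%:M (- 1%:M) 1%:M 0 : 'M[F]_(n + n)) :
  S^T = S -> Z^T = Z ->
  J *m (closed_loop K L N *m P + P *m (closed_loop K L N)^T) *m J^T =
  block_mx (lyap_ee S L) (lyap_ex (S + Z) K L N Z S)
    (lyap_ex (S + Z) K L N Z S)^T (lyap_xx (S + Z) K Z).
Proof.
move=> Ss Zs; rewrite /closed_loop /P /J /lyap_ee /lyap_ex /lyap_xx.
rewrite !(tr_block_mx, mulmx_block, add_block_mx, trmxD, trmxN, trmx_mul,
  trmxK, trmx1, trmx0).
rewrite Ss Zs; congr block_mx; mx_ring.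
Qed.

(** The plant state is the sum of the error and the controller state, whence the unipotent
    congruence. *)
Lemma pdmx_joint_covariance S Z :
  pdmx (block_mx (S + Z) Z Z Z) <-> pdmx S /\ pdmx Z.
Proof.
rewrite -pdmx_block_diag -(@pdmx_congrE _ _ (block_mx 1%:M 1%:M 0 1%:M)
  (block_mx S 0 0 Z)).
  rewrite tr_block_mx !mulmx_block !trmx1 trmx0.
  by rewrite !(mul1mx, mulmx1, mulmx0, mul0mx, addr0, add0r).
by rewrite unitmxE det_ublock !det1 mulr1 unitr1.
Qed.

Lemma closed_loop_lyapunov_pdmx S Z K L N (P := block_mx (S + Z) Z Z Z) :
  S^T = S -> Z^T = Z ->
  pdmx (- (closed_loop K L N *m P + P *m (closed_loop K L N)^T)) <->
  pdmx (- block_mx (lyap_ee S L) (lyap_ex (S + Z) K L N Z S)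
    (lyap_ex (S + Z) K L N Z S)^T (lyap_xx (S + Z) K Z)).
Proof.
move=> Ss Zs; rewrite -closed_loop_lyapunovE// -mulNmx -mulmxN pdmx_congrE//.
have /mulmx1_unit[//] : block_mx 1%:M (- 1%:M) 1%:M 0 *m
    block_mx 0 1%:M (- 1%:M) 1%:M = 1%:M :> 'M[F]_(n + n).
rewrite mulmx_block !(mul1mx, mulmx1, mulmx0, mul0mx, addr0, add0r, mulNmx, opprK).
by rewrite subrr -scalar_mx_block.
Qed.

(* [Y^-1] stands for the covariance of the estimation error and [X] for that of the
   plant state; all conditions are convex. *)
Definition feasible X Y G H :=
  [/\ pdmx (block_mx Y 1%:M 1%:M X),
      pdmx (- ((A *m X + B *m G) + (A *m X + B *m G)^T)) &
      pdmx (- ((Y *m A - H *m C) + (Y *m A - H *m C)^T))].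

(* The controller for which the off-diagonal block [lyap_ex] vanishes. *)
Definition canonical_controller X Y G H : 'M[F]_(m + n, p + n) :=
  let S := invmx Y in let Z := X - S in
  block_mx 0 (G *m invmx Z) (S *m H)
    ((A *m X + B *m G + S *m A^T - S *m H *m C *m X) *m invmx Z).

(** A Schur complement replaces the inverse in [X - invmx Y] by a condition affine in [X] and
    [Y]. *)
Lemma pdmx_coupling X Y :
  pdmx (block_mx Y 1%:M 1%:M X) <-> pdmx Y /\ pdmx (X - invmx Y).
Proof.
split=> [XYp|[Yp XYp]].
  have [Yp _] := pdmx_block_sub XYp; move: XYp; rewrite -{1}trmx1.
  by move=> /(pdmx_schur_ul _ _ Yp.1 (pdmx_unit Yp)); rewrite mul1mx trmx1 mulmx1.
rewrite -{1}trmx1; apply/(pdmx_schur_ul _ _ Yp.1 (pdmx_unit Yp)).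
by rewrite mul1mx trmx1 mulmx1.
Qed.

(** With [S = invmx Y] and [L = S *m H], congruence by [Y] turns the error inequality into one
    linear in [Y] and [H]. *)
Lemma lyap_ee_congr Y H : Y \in unitmx -> Y^T = Y ->
  Y *m lyap_ee (invmx Y) (invmx Y *m H) *m Y =
  (Y *m A - H *m C) + (Y *m A - H *m C)^T.
Proof.
move=> Yu Ys; rewrite /lyap_ee mulmxDr mulmxDl !mulmxA mulmxKV// mulmxV// mul1mx.
rewrite mulmxBr !mulmxA mulmxV// mul1mx; congr (_ + _).
by rewrite !(trmxD, trmxN, trmx_mul, trmx_inv) Ys mulmxBl !mulmxA mulmxKV.
Qed.

Lemma closed_loop_stab S Z K L N : pdmx S -> pdmx Z ->
  pdmx (- block_mx (lyap_ee S L) (lyap_ex (S + Z) K L N Z S)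
    (lyap_ex (S + Z) K L N Z S)^T (lyap_xx (S + Z) K Z)) ->
  stabilizing_controllers A B C (block_mx 0 K L N).
Proof.
move=> Sp Zp /(closed_loop_lyapunov_pdmx _ _ _ Sp.1 Zp.1) Lp.
exists N, L, K; split=> //; apply: lyapunov_stable Lp.
exact/pdmx_joint_covariance.
Qed.

Lemma pdmx_opp_block_diag S Z :
  pdmx (- block_mx S 0 0 Z) <-> pdmx (- S) /\ pdmx (- Z).
Proof. by rewrite opp_block_mx !oppr0; exact: pdmx_block_diag. Qed.

(** As [lyap_ex] vanishes, the Lyapunov block matrix is block diagonal, and its blocks are negative
    by the last two conditions of [feasible]. *)
Lemma canonical_controller_stab X Y G H : feasible X Y G H ->
  stabilizing_controllers A B C (canonical_controller X Y G H).
Proof.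
move=> [/pdmx_coupling[Yp Zp] Xlyap Ylyap].
have Yu := pdmx_unit Yp; have Zu := pdmx_unit Zp; have Sp := pdmx_inv Yp.
apply: (closed_loop_stab Sp Zp).
have XE : invmx Y + (X - invmx Y) = X by rewrite addrC subrK.
rewrite {}XE.
have -> : lyap_ex X (G *m invmx (X - invmx Y)) (invmx Y *m H)
    ((A *m X + B *m G + invmx Y *m A^T - invmx Y *m H *m C *m X) *m
     invmx (X - invmx Y)) (X - invmx Y) (invmx Y) = 0.
  by rewrite /lyap_ex !mulmxA !mulmxKV// subrr.
rewrite trmx0; apply/pdmx_opp_block_diag; split.
  rewrite -(@pdmx_congrE _ _ Y)// Yp.1 mulmxN mulNmx lyap_ee_congr//; exact: Yp.1.
by rewrite /lyap_xx !mulmxA !mulmxKV.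
Qed.

Lemma feasible_segment X0 Y0 G0 H0 X1 Y1 G1 H1 t : 0 <= t <= 1 ->
  feasible X0 Y0 G0 H0 -> feasible X1 Y1 G1 H1 ->
  feasible ((1 - t) *: X0 + t *: X1) ((1 - t) *: Y0 + t *: Y1)
    ((1 - t) *: G0 + t *: G1) ((1 - t) *: H0 + t *: H1).
Proof.
move=> t01 [c0 x0 y0] [c1 x1 y1]; split.
- have := pdmx_segment t01 c0 c1; rewrite !scale_block_mx add_block_mx.
  by rewrite -!scalerDl subrK scale1r.
- have := pdmx_segment t01 x0 x1; congr pdmx.
  by rewrite !trmxD !trmx_mul !trmxD ![(_ *: _)^T]linearZ /=; mx_ring.
- have := pdmx_segment t01 y0 y1; congr pdmx.
  by rewrite !trmxD !trmxN !trmx_mul !trmxD ![(_ *: _)^T]linearZ /=; mx_ring.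
Qed.

(** The path is the image of a segment of feasible data; it is continuous because [Y] and
    [X - invmx Y] stay positive definite, hence invertible. *)
Lemma canonical_controller_joined X0 Y0 G0 H0 X1 Y1 G1 H1 :
  feasible X0 Y0 G0 H0 -> feasible X1 Y1 G1 H1 ->
  path_joined F (stabilizing_controllers A B C)
    (canonical_controller X0 Y0 G0 H0) (canonical_controller X1 Y1 G1 H1).
Proof.
move=> f0 f1; pose l i j (M0 M1 : 'M[F]_(i, j)) (t : F) := (1 - t) *: M0 + t *: M1.
have l0 i j M0 M1 : @l i j M0 M1 0 = M0.
  by rewrite /l subr0 scale1r scale0r addr0.
have l1 i j M0 M1 : @l i j M0 M1 1 = M1.
  by rewrite /l subrr scale1r scale0r add0r.
pose f t := canonical_controller (l _ _ X0 X1 t) (l _ _ Y0 Y1 t) (l _ _ G0 G1 t)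
  (l _ _ H0 H1 t).
have ft t : 0 <= t <= 1 ->
    feasible (l _ _ X0 X1 t) (l _ _ Y0 Y1 t) (l _ _ G0 G1 t) (l _ _ H0 H1 t).
  by move=> t01; exact: feasible_segment.
have := @path_joinedP _ _ (stabilizing_controllers A B C) f.
rewrite /f !l0 !l1; apply=> t t01; first exact/canonical_controller_stab/ft.
have [/pdmx_coupling[/pdmx_unit Yu /pdmx_unit Zu] _ _] := ft t t01.
set W := within _ _; have FW : Filter W by exact: within_filter.
have lc i j M0 M1 : @l i j M0 M1 s @[s --> W] --> @l i j M0 M1 t.
  apply: cvgD; apply: cvgZ; try exact: cvg_cst; last exact: cvg_within.
  by apply: cvgB; [exact: cvg_cst|exact: cvg_within].
have Sc := cvg_invmx (FG := FW) Yu (lc _ _ Y0 Y1).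
have Zc : invmx (l _ _ X0 X1 s - invmx (l _ _ Y0 Y1 s)) @[s --> W] -->
    invmx (l _ _ X0 X1 t - invmx (l _ _ Y0 Y1 t)).
  by apply: cvg_invmx => //; apply: (cvgB _ Sc); exact: lc.
have cstM i j k (M : 'M[F]_(i, j)) (g : F -> 'M[F]_(j, k)) (N : 'M[F]_(j, k)) :
    g @ W --> N -> M *m g s @[s --> W] --> M *m N.
  by apply: cvg_mulmx; exact: cvg_cst.
rewrite /canonical_controller; apply: cvg_block_mx; first exact: cvg_cst.
- by apply: cvg_mulmx (Zc); exact: lc.
- by apply: (cvg_mulmx Sc); exact: lc.
apply: cvg_mulmx (Zc); apply: cvgB.
  apply: cvgD; last by apply: (cvg_mulmx Sc); exact: cvg_cst.
  by apply: cvgD; apply: cstM; exact: lc.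
apply: cvg_mulmx; last exact: lc.
apply: cvg_mulmx; last exact: cvg_cst.
by apply: (cvg_mulmx Sc); exact: lc.
Qed.

End Controllers.

(** * Changes of controller coordinates *)

Section Similarity.
Context {F : realType} {n m p : nat}.
Variables (A : 'M[F]_n) (B : 'M[F]_(n, m)) (C : 'M[F]_(p, n)).

Local Notation Cn := (stabilizing_controllers A B C).

(** The controller in the state coordinates [T xi], written as a matrix product so that continuity
    in [T] and in [K] follows from that of products and inverses. *)
Definition similar_controller (T : 'M[F]_n) (K : 'M[F]_(m + n, p + n)) :=
  block_mx 1%:M 0 0 T *m K *m block_mx 1%:M 0 0 (invmx T).

Lemma similar_controllerE T K L N :
  similar_controller T (block_mx 0 K L N) =
  block_mx 0 (K *m invmx T) (T *m L) (T *m N *m invmx T).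
Proof.
rewrite /similar_controller !mulmx_block.
by rewrite !(mul1mx, mulmx1, mulmx0, mul0mx, addr0, add0r).
Qed.

Lemma similar_controller1 K : similar_controller 1%:M K = K.
Proof.
by rewrite /similar_controller invmx1 -!scalar_mx_block mul1mx mulmx1.
Qed.

Lemma similar_controllerM T U K : T \in unitmx -> U \in unitmx ->
  similar_controller T (similar_controller U K) = similar_controller (T *m U) K.
Proof.
move=> Tu Uu; rewrite /similar_controller !mulmxA mulmx_block -mulmxA mulmx_block.
rewrite !(mul1mx, mulmx1, mulmx0, mul0mx, addr0, add0r).
suff -> : invmx (T *m U) = invmx U *m invmx T by [].
apply: (can_inj (mulKmx (_ : T *m U \in unitmx))); first by rewrite unitmx_mul Tu.
by rewrite mulmxV ?unitmx_mul ?Tu// mulmxA mulmxK// mulmxV.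
Qed.

Lemma block_diag_unitmx (T : 'M[F]_n) : T \in unitmx ->
  (block_mx 1%:M 0 0 T : 'M[F]_(n + n)) \in unitmx /\
  invmx (block_mx 1%:M 0 0 T) = block_mx 1%:M 0 0 (invmx T) :> 'M[F]_(n + n).
Proof.
move=> Tu; have Du : (block_mx 1%:M 0 0 T : 'M[F]_(n + n)) \in unitmx.
  by rewrite unitmx_lblock unitmx1.
split=> //; apply: (can_inj (mulKmx Du)); rewrite mulmxV//.
rewrite mulmx_block !(mul1mx, mulmx1, mulmx0, mul0mx, addr0, add0r) mulmxV//.
by rewrite -scalar_mx_block.
Qed.

Lemma closed_loop_similar T K L N (D : 'M[F]_(n + n) := block_mx 1%:M 0 0 T) :
  T \in unitmx ->
  closed_loop A B C (K *m invmx T) (T *m L) (T *m N *m invmx T) =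
  D *m closed_loop A B C K L N *m invmx D.
Proof.
move=> Tu; rewrite /D (block_diag_unitmx Tu).2 /closed_loop !mulmx_block.
by rewrite !(mul1mx, mulmx1, mulmx0, mul0mx, addr0, add0r, mulmxA).
Qed.

(** A Lyapunov certificate [P] of the closed loop is carried along by congruence with the block
    diagonal matrix of [1] and [T]. *)
Lemma similar_controller_stab T K : T \in unitmx -> Cn K ->
  Cn (similar_controller T K).
Proof.
move=> Tu [N [L [G [-> Ks]]]]; rewrite similar_controllerE.
exists (T *m N *m invmx T), (T *m L), (G *m invmx T); split; first by [].
have [Du _] := block_diag_unitmx Tu; have [P Pp Lp] := stable_lyapunov Ks.
have := closed_loop_similar G L N Tu; rewrite /closed_loop => ->.
apply: (@lyapunov_stable _ _ _ (block_mx 1%:M 0 0 T *m P *m (block_mx 1%:M 0 0 T)^T)).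
  exact: pdmx_congr.
by rewrite lyapunov_similar// -mulNmx -mulmxN; exact: pdmx_congr.
Qed.

(** A path of invertible matrices from [1] to [T] moves [K] through stabilizing controllers. *)
Lemma similar_controller_joined T K : 0 < \det T -> Cn K ->
  path_joined F Cn K (similar_controller T K).
Proof.
move=> T0 SK; rewrite -{1}[K]similar_controller1.
apply: (@path_joined_map _ _ _ [set U : 'M[F]_n | U \in unitmx] _
  (similar_controller^~ K)).
- move=> U /= Uu; rewrite /similar_controller.
  apply: (@cvg_mulmx _ _ (nbhs U)); last first.
    apply: (@cvg_block_mx _ _ (nbhs U)); [exact: cvg_cst..|].
    exact: (@cvg_invmx _ _ (nbhs U)).
  apply: (@cvg_mulmx _ _ (nbhs U)); last exact: cvg_cst.
  by apply: (@cvg_block_mx _ _ (nbhs U)); [exact: cvg_cst..|exact: cvg_id].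
- by move=> U Uu; exact: similar_controller_stab.
by apply: GL_path_joined; rewrite det1 mul1r.
Qed.

Lemma similar_controller_map T K K' : T \in unitmx -> path_joined F Cn K K' ->
  path_joined F Cn (similar_controller T K) (similar_controller T K').
Proof.
move=> Tu; apply: (@path_joined_map _ _ _ Cn Cn (similar_controller T)).
  move=> U _; rewrite /similar_controller.
  apply: (@cvg_mulmx _ _ (nbhs U)); last exact: cvg_cst.
  by apply: (@cvg_mulmx _ _ (nbhs U)); [exact: cvg_cst|exact: cvg_id].
by move=> U; exact: similar_controller_stab.
Qed.


End Similarity.

(** * Joining a controller, up to similarity, to a canonical one *)

Section NormalForm.
Context {F : realType} {n m p : nat}.
Variables (A : 'M[F]_n) (B : 'M[F]_(n, m)) (C : 'M[F]_(p, n)).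

Local Notation Cn := (stabilizing_controllers A B C).

(** Among the [n + 1] distinct numbers [- d / (k + 1)] one is not a root of the characteristic
    polynomial, which has degree [n]. *)
Lemma unitmx_perturb (M : 'M[F]_n) d : 0 < d ->
  exists2 e, 0 <= e <= d & M + e%:M \in unitmx.
Proof.
move=> d0; pose e (k : nat) := d / k.+1%:R.
have e_itv k : 0 <= e k <= d.
  rewrite divr_ge0 ?(ltW d0)//= ler_pdivrMr ?ltr0n// ler_peMr ?(ltW d0)//.
  by rewrite ler1n.
have e_inj : injective e.
  move=> j k /(mulfI (lt0r_neq0 d0))/invr_inj/eqP.
  by rewrite eqr_nat => /eqP[].
have [/allP roots|] := boolP (all (root (char_poly M)) [seq - e k | k <- iota 0 n.+1]).
  have /max_poly_roots : char_poly M != 0 by rewrite monic_neq0 ?char_poly_monic.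
  move=> /(_ _ (introT allP roots)); rewrite size_map size_iota size_char_poly ltnn.
  by rewrite map_inj_uniq ?iota_uniq => [/(_ isT)//|j k /oppr_inj/e_inj].
move=> /allPn[_ /mapP[k _ ->]]; rewrite -eigenvalue_root_char eigenvalue_unitmx.
rewrite negbK raddfN opprK => Mu.
by exists (e k).
Qed.

(** Both inequalities survive a small multiple of the symmetric [E], which shifts the off-diagonal
    block by a scalar matrix; a suitable shift makes that block invertible. *)
Lemma lyapunov_perturb (P M : 'M[F]_(n + n)) :
  pdmx P -> pdmx (- (M *m P + P *m M^T)) ->
  exists (X Pi Z : 'M[F]_n) (Q := block_mx X Pi Pi^T Z),
    [/\ pdmx Q, pdmx (- (M *m Q + Q *m M^T)) & Pi \in unitmx].
Proof.
move=> Pp Lp; pose E : 'M[F]_(n + n) := block_mx 0 1%:M 1%:M 0.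
have Es : E^T = E by rewrite tr_block_mx !trmx1 !trmx0.
have [d d0 Pd] := pdmx_perturb Pp Es.
have [|d' d'0 Ld] := @pdmx_perturb _ _ _ (- (M *m E + E *m M^T)) Lp.
  by rewrite trmxN trmxD !trmx_mul trmxK Es addrC.
have dd0 : 0 < Num.min d d' by rewrite lt_min d0.
have [e /andP[e0]] := unitmx_perturb (ursubmx P) dd0.
rewrite le_min => /andP[ed ed'] Pu.
exists (ulsubmx P), (ursubmx P + e%:M), (drsubmx P).
have -> : block_mx (ulsubmx P) (ursubmx P + e%:M) (ursubmx P + e%:M)^T
    (drsubmx P) = P + e *: E.
  have PE : dlsubmx P = (ursubmx P)^T by rewrite trmx_ursub Pp.1.
  transitivity (block_mx (ulsubmx P) (ursubmx P) (dlsubmx P) (drsubmx P) + e *: E).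
    rewrite PE scale_block_mx !scaler0 add_block_mx !addr0.
    by rewrite scalemx1 trmxD tr_scalar_mx.
  by rewrite submxK.
split=> //; first by apply: Pd; rewrite e0.
have := Ld e; rewrite e0 ed' => /(_ isT); congr pdmx.
by rewrite mulmxDr mulmxDl -!scalemxAl -!scalemxAr; mx_ring.
Qed.

(** Only [N] moves. Along the segment the off-diagonal block is scaled by [1 - t], so the Lyapunov
    matrix runs linearly from the given one to its block diagonal part, and both ends are negative
    definite. *)
Lemma canonical_controller_segment (S Z : 'M[F]_n) K L N :
  pdmx S -> pdmx Z ->
  pdmx (- block_mx (lyap_ee A C S L) (lyap_ex A B C (S + Z) K L N Z S)
    (lyap_ex A B C (S + Z) K L N Z S)^T (lyap_xx A B (S + Z) K Z)) ->
  exists X Y G H, feasible A B C X Y G H /\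
    path_joined F Cn (block_mx 0 K L N) (canonical_controller A B C X Y G H).
Proof.
move=> Sp Zp Lp; have Zu := pdmx_unit Zp; have Su := pdmx_unit Sp.
have [eep xxp] : pdmx (- lyap_ee A C S L) /\ pdmx (- lyap_xx A B (S + Z) K Z).
  by move: Lp; rewrite opp_block_mx => /pdmx_block_sub.
exists (S + Z), (invmx S), (K *m Z), (invmx S *m L).
have SZ : S + Z - S = Z by rewrite addrAC subrr add0r.
split.
  split.
  - by apply/pdmx_coupling; rewrite invmxK SZ; split=> //; exact: pdmx_inv.
  - by move: xxp; rewrite /lyap_xx mulmxA.
  - have iSu : invmx S \in unitmx by rewrite unitmx_inv.
    have iSs : (invmx S)^T = invmx S by rewrite trmx_inv Sp.1.
    rewrite -lyap_ee_congr// invmxK mulmxA mulmxV// mul1mx.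
    rewrite -mulNmx -mulmxN -{2}iSs; exact: pdmx_congr.
set D := lyap_ex A B C (S + Z) K L N Z S in Lp.
have -> : canonical_controller A B C (S + Z) (invmx S) (K *m Z) (invmx S *m L) =
    block_mx 0 K L (N + D *m invmx Z).
  rewrite /canonical_controller invmxK SZ mulKVmx// mulmxK// mulmxA.
  congr block_mx; rewrite /D /lyap_ex.
  by rewrite [in RHS]mulmxBl mulmxK// [RHS]addrC subrK.
apply: path_joined_segment => t t01.
rewrite !scale_block_mx add_block_mx !scaler0 addr0 -!scalerDl subrK !scale1r.
rewrite scalerDr addrA -scalerDl subrK scale1r.
apply: (closed_loop_stab Sp Zp).
have -> : lyap_ex A B C (S + Z) K L (N + t *: (D *m invmx Z)) Z S = (1 - t) *: D.
  rewrite /lyap_ex mulmxDl -scalemxAl mulmxKV// opprD addrA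
    -/(lyap_ex _ _ _ _ _ _ _ _ _) -/D.
  by rewrite scalerBl scale1r.
have diagp : pdmx (- block_mx (lyap_ee A C S L) 0 0 (lyap_xx A B (S + Z) K Z)).
  exact/pdmx_opp_block_diag.
have := pdmx_segment t01 Lp diagp; congr pdmx.
rewrite !scalerN -opprD !scale_block_mx add_block_mx !scaler0 !addr0.
by rewrite -!scalerDl subrK !scale1r [in RHS]linearZ.
Qed.

Lemma similar_canonical_joined K : Cn K -> exists T X Y G H,
  [/\ T \in unitmx, feasible A B C X Y G H &
    path_joined F Cn (similar_controller T K) (canonical_controller A B C X Y G H)].
Proof.
move=> [N [L [G [-> Ks]]]]; have [P Pp Lp] := stable_lyapunov Ks.
have [X [Pi [W [Qp LQ Pu]]]] := lyapunov_perturb Pp Lp.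
have [_ Wp] := pdmx_block_sub Qp; have Wu := pdmx_unit Wp.
(* With this [T], the cross covariance [Pi *m T^T] and the controller covariance [T *m W *m T^T]
   both equal [Z]; [T] is invertible because [Pi] is. *)
pose T := Pi *m invmx W; have Tu : T \in unitmx by rewrite unitmx_mul Pu unitmx_inv.
pose Z := Pi *m invmx W *m Pi^T.
have [Du _] := block_diag_unitmx Tu.
have QE : block_mx 1%:M 0 0 T *m block_mx X Pi Pi^T W *m (block_mx 1%:M 0 0 T)^T =
    block_mx ((X - Z) + Z) Z Z Z.
  rewrite tr_block_mx !mulmx_block !(trmx0, trmx1).
  rewrite !(mul1mx, mulmx1, mulmx0, mul0mx, addr0, add0r) subrK.
  have TE : T^T = invmx W *m Pi^T by rewrite trmx_mul trmx_inv Wp.1.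
  by rewrite /T -/T TE /T mulmxKV// !mulmxA.
have Q'p := pdmx_congr Du Qp; rewrite QE in Q'p.
have [Sp Zp] := (pdmx_joint_covariance _ _).1 Q'p.
have := pdmx_congr Du LQ; rewrite mulmxN mulNmx -lyapunov_similar// QE.
have := closed_loop_similar A B C G L N Tu; rewrite /closed_loop => <-.
move=> /(closed_loop_lyapunov_pdmx _ _ _ _ _ _ Sp.1 Zp.1) L'p.
have [X' [Y' [G' [H' [feas joined]]]]] := canonical_controller_segment Sp Zp L'p.
by exists T, X', Y', G', H'; split=> //; rewrite similar_controllerE.
Qed.

End NormalForm.

(** * Two representatives suffice *)

Lemma det_lt0_exists (F : realType) n : (0 < n)%N -> exists r : 'M[F]_n, \det r < 0.
Proof.
case: n => // n _; pose r : 'M[F]_(1 + n) := block_mx (- 1)%:M 0 0 1%:M.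
suff r0 : \det r < 0 by exists r.
by rewrite det_ublock det1 mulr1 det_scalar1 ltrN10.
Qed.

Theorem theorem3p1 (F : realType) (n m p : nat)
    (n_gt0 : (0 < n)%N) (m_gt0 : (0 < m)%N) (p_gt0 : (0 < p)%N)
    (A : 'M[F]_n) (B : 'M[F]_(n, m)) (C : 'M[F]_(p, n))
    (W : 'M[F]_n) (V : 'M[F]_p) (Q : 'M[F]_n) (R : 'M[F]_m)
    (W_psd : psdmx W) (V_pd : pdmx V) (Q_psd : psdmx Q) (R_pd : pdmx R)
    (sqrtW sqrtQ : 'M[F]_n)
    (sqrtWP : is_psd_sqrt sqrtW W) (sqrtQP : is_psd_sqrt sqrtQ Q)
    (ctrlAB : controllable A B) (ctrlAW : controllable A sqrtW)
    (obsCA : observable C A) (obsQA : observable sqrtQ A) :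
  path_components F (stabilizing_controllers A B C) #<= `I_2.
Proof.
set S := stabilizing_controllers A B C.
have [[K0 SK0]|noK] := pselect (exists K, S K); last first.
  (* With [S] empty, the representatives are arbitrary. *)
  apply: (@path_components_le2 _ _ S (0 : 'M[F]_(m + n, p + n)) 0) => K SK.
  by case: noK; exists K.
have [_ [X0 [Y0 [G0 [H0 [_ feas0 _]]]]]] := similar_canonical_joined SK0.
have [r r0] := det_lt0_exists F n_gt0.
have ru : r \in unitmx by rewrite unitmxE unitfE lt_eqF.
pose c0 := canonical_controller A B C X0 Y0 G0 H0.
apply: (@path_components_le2 _ _ S c0 (similar_controller r c0)) => K SK.
have [T [X [Y [G [H [Tu feas TK]]]]]] := similar_canonical_joined SK.
have {}TK : path_joined F S (similar_controller T K) c0.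
  by apply: path_joined_trans TK _; exact: canonical_controller_joined.
have [T0|T0|T0] := ltgtP (\det T) 0.
(* Both [r] and [T] have negative determinant, so [r *m T] has a positive one: [K] is joined to its
   conjugate by [r *m T], which is joined to the conjugate of [c0] by [r]. *)
- right; apply: path_joined_trans (similar_controller_map ru TK).
  rewrite similar_controllerM//; apply: similar_controller_joined => //.
  by rewrite det_mulmx nmulr_rgt0.
- left; apply: path_joined_trans TK; exact: similar_controller_joined.
- by move: Tu; rewrite unitmxE T0 unitr0.
Qed.
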